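(* Let $b \ge 1$ be an integer, let $n = 2^b - 1$, and let $\phi : \{0,\dots,n\} \to \{0,\dots,n\}$ be a contrast enhancement transform with associated $(n+1)\times(n+1)$ matrix $T_\phi$. For a vector $\mathbf{h} = (h_1,\dots,h_{n+1}) \in \mathbb{R}^{n+1}$ define $$\Omega(\mathbf{h}) = \sum_{i=1}^{n+1} \mathbf{1}(h_i = 0),$$ the number of empty bins of $\mathbf{h}$. Then for every pixel histogram $\mathbf{h} \in \Delta^{n+1}$, $$\Omega(\mathbf{h}) \le \Omega(T_\phi \mathbf{h}).$$
   Context: $\mathbf{1}(c)$ equals $1$ if the condition $c$ is true and $0$ otherwise. A (normalized) pixel histogram of a $b$-bit image is a vector in the probability simplex $\Delta^{n+1} = \{\mathbf{h} \in \mathbb{R}^{n+1} : h_k \ge 0 \text{ for all } k,\ \sum_{k=1}^{n+1} h_k = 1\}$, where $h_{i+1}$ is the fraction of pixels with value $i$, for $i = 0,\dots,n$. A contrast enhancement transform is a map $\phi : \{0,\dots,n\} \to \{0,\dots,n\}$ of the form $\phi(i) = [m(i)]$, where $m : [0,n] \to [0,n]$ is a continuous non-decreasing function and $[\cdot]$ is rounding to the nearest integer, with half-integers rounded up (i.e. $[x] = j$ iff $j - \frac12 \le x < j + \frac12$). The matrix $T_\phi$ is the $(n+1)\times(n+1)$ matrix with entries $(T_\phi)_{j+1,\,i+1} = \mathbf{1}(j = \phi(i))$ for $i,j \in \{0,\dots,n\}$. Thus each column of $T_\phi$ sums to one, and $(T_\phi \mathbf{h})_{j+1} = \sum_{i=0}^{n}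 \mathbf{1}(j = \phi(i))\, h_{i+1}$. *)

(* Defs.v *)
From mathcomp Require Import all_boot all_order all_algebra.
From mathcomp Require Import all_classical all_reals all_analysis.

Set Implicit Arguments.
Unset Strict Implicit.
Unset Printing Implicit Defensive.

Import Order.TTheory GRing.Theory Num.Theory.
Import numFieldNormedType.Exports.

Local Open Scope classical_set_scope.
Local Open Scope ring_scope.

(* Nearest integer, half-integers rounded up; round_half_upP is the intended
   characterization. *)
Definition round_half_up (R : realType) (x : R) : int :=
  Num.floor (x + 2%:R^-1).

Lemma round_half_upP (R : realType) (x : R) (j : int) :
  round_half_up x = j <-> j%:~R - 2%:R^-1 <= x < j%:~R + 2%:R^-1.
Proof.
rewrite lerBlDr.
have shift : (x < j%:~R + 2%:R^-1) = (x + 2%:R^-1 < (j + 1)%:~R).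
  by rewrite intrD [X in _ = (_ < _ + X)]splitr mul1r addrA ltrD2r.
rewrite shift; split => [<-|]; last exact: floor_def.
exact: floor_itv.
Qed.

(* The tone curve [0, n] -> [0, n] is encoded as a total function m on R that
   is only constrained, and only evaluated, on [0, n]; continuity is for the
   subspace topology of [0, n]. *)
Definition contrast_enhancement (R : realType) (n : nat)
    (phi : 'I_n.+1 -> 'I_n.+1) : Prop :=
  exists m : R -> R,
    [/\ forall x, x \in `[0, n%:R] -> m x \in `[0, n%:R],
        {within `[0, n%:R], continuous m},
        {in `[0, n%:R] &, {homo m : x y / x <= y}}
      & forall i : 'I_n.+1, (phi i)%:Z = round_half_up (m i%:R)].

Definition histogram (R : realType) (n : nat) (h : 'cV[R]_n.+1) : Prop :=
  (forall k, 0 <= h k 0) /\ \sum_k h k 0 = 1.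

(* Bins are numbered from 0: h k 0 is the fraction of pixels with value k. *)
Definition transform_mx (R : realType) (n : nat) (phi : 'I_n.+1 -> 'I_n.+1) :
    'M[R]_n.+1 :=
  \matrix_(j, i) (j == phi i)%:R.

Definition empty_bins (R : realType) (n : nat) (h : 'cV[R]_n.+1) : nat :=
  (\sum_(i < n.+1) (h i 0 == 0)%R)%N.

(* Main.v *)
(* Every nonempty bin of [T_phi h] is the image under [phi] of a nonempty bin
   of [h], so [T_phi] cannot increase the number of nonempty bins. *)
Require Import Defs.
From mathcomp Require Import all_boot all_order all_algebra.
From mathcomp Require Import all_classical all_reals all_analysis.

(** Empty and nonempty bins together number [n.+1] ([empty_bins_card]), so it suffices to compare
    supports. A nonzero sum has a nonzero term, hence the support of the transformed vector lies in
    the [phi]-image of the support of [h], and an image is no larger than its source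
    ([card_support_transform]). *)

Lemma empty_bins_card (R : realType) (n : nat) (h : 'cV[R]_n.+1) :
  (empty_bins h + #|[pred i | h i ord0 != 0%R]| = n.+1)%N.
Proof.
rewrite -[RHS](card_ord n.+1) -(cardC [pred i | h i ord0 == 0%R]); congr addn.
rewrite -sum1_card [RHS]big_mkcond; apply: eq_bigr => i _.
by rewrite inE; case: eqP.
Qed.

Lemma transform_mxE (R : realType) (n : nat) (phi : 'I_n.+1 -> 'I_n.+1)
    (h : 'cV[R]_n.+1) (j : 'I_n.+1) :
  ((transform_mx R phi *m h) j ord0 = \sum_(i | j == phi i) h i ord0)%R.
Proof.
rewrite mxE [RHS]big_mkcond; apply: eq_bigr => i _.
by rewrite mxE; case: eqP => _; rewrite ?GRing.mul1r ?GRing.mul0r.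
Qed.

Lemma card_support_transform (R : realType) (n : nat)
    (phi : 'I_n.+1 -> 'I_n.+1) (h : 'cV[R]_n.+1) :
  (#|[pred j | (transform_mx R phi *m h)%R j ord0 != 0%R]|
     <= #|[pred i | h i ord0 != 0%R]|)%N.
Proof.
apply: leq_trans (leq_image_card phi [pred i | h i ord0 != 0%R]).
apply/subset_leq_card/fintype.subsetP => j; rewrite inE transform_mxE.
(* Contrapositive: for [j] outside the image, each term of the fibre sum over [j] is zero. *)
apply: contraR => jNim; apply/eqP/big1 => i /eqP ji.
by apply/eqP; apply: contraNT jNim => hi; rewrite ji fintype.image_f.
Qed.

Theorem theorem1 (R : realType) (b n : nat) (hb : (1 <= b)%N)
    (hn : n = (2 ^ b - 1)%N) (phi : 'I_n.+1 -> 'I_n.+1)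
    (hphi : contrast_enhancement R phi) (h : 'cV[R]_n.+1)
    (hh : histogram h) :
  (empty_bins h <= empty_bins (transform_mx R phi *m h)%R)%N.
Proof.
rewrite -(leq_add2r #|[pred i | h i ord0 != 0%R]|) empty_bins_card.
(* The left side is now [n.+1]; splitting it again for the transformed vector leaves only the
   supports to compare. *)
rewrite -[leqLHS](empty_bins_card R n (transform_mx R phi *m h)%R).
by rewrite leq_add2l card_support_transform.
Qed.
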